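(* For any integer $n \geq 0$ (with $a$ denoting a nonnegative integer), $$v_2(B_n(3,2)) = \begin{cases} 1, & \text{if } n \equiv 4 \pmod{8}, \\ 3, & \text{if } n \equiv 8 \pmod{16}, \\ 1 + v_2 \big( a(a+1) \big), & \text{if } n=4a+1 \text{ and } v_2\big( a(a+1) \big) \leq 4, \\ 0, & \text{if } n \equiv 2 \pmod{4}, \\ 0, & \text{if } n \equiv 3 \pmod{4}. \end{cases}$$ (No assertion is made for values of $n$ not covered by these cases.)
   Context: The sequence $\{B_n(3,2)\}_{n\geq 0}$ is defined by $B_n = B_{n-1}+B_{n-2}+B_{n-3}$ for $n \geq 3$, with $(B_0,B_1,B_2)=(0,0,1)$. $v_2$ denotes the 2-adic order (2-adic valuation), with the convention $v_2(0)=+\infty$. *)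

(* Defs.v *)
From mathcomp Require Import all_boot all_order all_algebra.
From mathcomp Require Import constructive_ereal.
Set Implicit Arguments.
Unset Strict Implicit.
Unset Printing Implicit Defensive.

(* The sequence B_n(3,2), with (B_0, B_1, B_2) = (0, 0, 1). *)
Fixpoint B32 (n : nat) : nat :=
  match n with
  | 0 => 0
  | 1 => 0
  | 2 => 1
  | ((k.+1 as l).+1 as m).+1 => B32 m + B32 l + B32 k
  end.

(* Valued in the extended integers because [logn 2 0 = 0], whereas the
   convention here is v_2(0) = +oo. *)
Definition v2 (m : nat) : \bar int :=
  if m == 0 then +oo%E else ((logn 2 m)%:Z%R)%:E.

(* Main.v *)
Require Import Defs.
From mathcomp Require Import all_boot all_order all_algebra.
From mathcomp Require Import constructive_ereal.
From mathcomp Require Import zify.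

(* The valuation of [m] is that of [m mod 2^k] unless the latter is 0.  Since
   [B_n mod 64] is periodic of period 128 and [a(a+1) mod 32] of period 32,
   every case amounts to a check of finitely many residues. *)

(** For [j <= k], [p ^ j] divides [m] exactly when it divides the remainder. As [p ^ k] divides
    neither, both valuations are below [k] and are decided by such powers. *)
Lemma logn_mod_pfactor (p k m : nat) :
  prime p -> m %% p ^ k != 0 -> logn p (m %% p ^ k) = logn p m.
Proof.
move=> p_pr r_neq0.
have r_gt0 : 0 < m %% p ^ k by rewrite lt0n.
have m_gt0 : 0 < m.
  by rewrite lt0n; apply: contraNneq r_neq0 => ->; rewrite mod0n.
have dvd_mod j : j <= k -> (p ^ j %| m %% p ^ k) = (p ^ j %| m).
  move=> le_jk; rewrite [in RHS](divn_eq m (p ^ k)) dvdn_addr //.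
  exact/dvdn_mull/dvdn_exp2l.
have lt_k s : 0 < s -> ~~ (p ^ k %| s) -> logn p s <= k.
  by move=> s_gt0; rewrite pfactor_dvdn // -ltnNge => /ltnW.
have ndvd_m : ~~ (p ^ k %| m) by [].
have ndvd_r : ~~ (p ^ k %| m %% p ^ k) by rewrite dvd_mod.
(* Each of the two inequalities becomes divisibility of one number by the exact power of [p] in the
   other. *)
apply/eqP; rewrite eqn_leq -!pfactor_dvdn // dvd_mod ?lt_k //.
by rewrite pfactor_dvdnn -dvd_mod ?lt_k // pfactor_dvdnn.
Qed.

Lemma v2_mod_pfactor (k m : nat) :
  m %% 2 ^ k != 0 -> v2 m = v2 (m %% 2 ^ k).
Proof.
move=> r_neq0; rewrite /v2 (negPf r_neq0) logn_mod_pfactor // ifN //.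
by apply: contraNneq r_neq0 => ->; rewrite mod0n.
Qed.

Definition trib_step (d : nat) (t : nat * nat * nat) : nat * nat * nat :=
  let: (x, y, z) := t in (y, z, (x + y + z) %% d).

(** A window of three consecutive terms, reduced modulo [d] at every step so that evaluation stays
    cheap. *)
Definition trib_state (d n : nat) : nat * nat * nat :=
  iter n (trib_step d) (0, 0, 1).

Lemma B32S (n : nat) : B32 n.+3 = B32 n + B32 n.+1 + B32 n.+2.
Proof. by rewrite addnC (addnC (B32 n)) addnA. Qed.

Lemma trib_stateE (d n : nat) : 1 < d ->
  trib_state d n = (B32 n %% d, B32 n.+1 %% d, B32 n.+2 %% d).
Proof.
move=> d_gt1; elim: n => [|n IHn]; first by rewrite /= !mod0n modn_small.
rewrite /trib_state iterS -/(trib_state d n) IHn /trib_step (B32S n).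
by rewrite modnDmr -[in LHS]modnDml modnDm modnDml.
Qed.

Lemma trib_state64_mod (n : nat) : trib_state 64 (n %% 128) = trib_state 64 n.
Proof.
rewrite [in RHS](divn_eq n 128) addnC /trib_state iterD; congr iter.
(* A single computation suffices: 128 steps modulo 64 bring [(0, 0, 1)] back to itself. *)
elim: (n %/ 128) => [//|q IHq]; rewrite mulSn iterD -IHq.
by apply/esym/eqP; vm_compute.
Qed.

Definition B32_mod64 (n : nat) : nat := (trib_state 64 n).1.1.

Lemma v2_B32 (n e : nat) :
  (B32_mod64 (n %% 128) != 0) && (logn 2 (B32_mod64 (n %% 128)) == e) ->
  v2 (B32 n) = (e%:Z%R)%:E.
Proof.
rewrite /B32_mod64 trib_state64_mod trib_stateE //= => /andP[r_neq0 /eqP <-].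
by rewrite (@v2_mod_pfactor 6) // {1}/v2 (negPf r_neq0).
Qed.

(** Since [d] divides 128, [n %% 128] lies in the same class modulo [d] as [n], so a check over one
    period is enough. *)
Lemma v2_B32_class (d c e n : nat) :
  d %| 128 ->
  all (fun i => (i == c %[mod d]) ==>
                (B32_mod64 i != 0) && (logn 2 (B32_mod64 i) == e))
      (iota 0 128) ->
  n = c %[mod d] -> v2 (B32 n) = (e%:Z%R)%:E.
Proof.
move=> d_dvd /allP check nc; apply: v2_B32.
have /check/implyP -> // : n %% 128 \in iota 0 128 by rewrite mem_iota ltn_mod.
by rewrite modn_dvdm // nc.
Qed.

Lemma v2_B32_1mod4 (a : nat) : (v2 (a * (a + 1)) <= 4%:E)%E ->
  v2 (B32 (4 * a + 1)) = (1%:E + v2 (a * (a + 1)))%E.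
Proof.
(* If [a * (a + 1)] is 0, its valuation is [+oo] and the bound fails. *)
rewrite {1}/v2; case: eqP => // /eqP; rewrite -lt0n => m_gt0.
rewrite lee_fin lez_nat => le4.
have m_neq0 : (a * (a + 1)) %% 2 ^ 5 != 0.
  by rewrite -/(dvdn _ _) pfactor_dvdn // -ltnNge.
rewrite [v2 (a * _)]/v2 eqn0Ngt m_gt0 -EFinD -PoszD; apply: v2_B32.
rewrite -(@logn_mod_pfactor 2 5 (a * _)) //.
have eq_b : (a * (a + 1)) %% 2 ^ 5 = ((a %% 32) * (a %% 32 + 1)) %% 2 ^ 5.
  by rewrite -modnMm -[in LHS](modnDml a) modnMm modnMml.
(* As 128 = 4 * 32, the index modulo 128 depends only on [a %% 32], like [a * (a + 1)] modulo 32. *)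
have -> : (4 * a + 1) %% 128 = 4 * (a %% 32) + 1.
  rewrite -modnDml -[128]/(4 * 32) -muln_modr modn_small //.
  by have := ltn_pmod a (isT : 0 < 32); lia.
rewrite eq_b in m_neq0 *.
(* The premise excludes just [b = 0] and [b = 31], because [b] and [b + 1] are coprime. *)
have : all (fun b => ((b * (b + 1)) %% 2 ^ 5 != 0) ==>
    (B32_mod64 (4 * b + 1) != 0) &&
    (logn 2 (B32_mod64 (4 * b + 1)) == 1 + logn 2 ((b * (b + 1)) %% 2 ^ 5)))
  (iota 0 32) by vm_compute.
by move/allP/(_ (a %% 32)); rewrite mem_iota ltn_mod => /(_ isT)/implyP; apply.
Qed.

Theorem theorem12 (n : nat) :
  [/\ n = 4 %[mod 8] -> v2 (B32 n) = 1%:E,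
      n = 8 %[mod 16] -> v2 (B32 n) = 3%:E,
      forall a : nat, n = 4 * a + 1 -> (v2 (a * (a + 1)) <= 4%:E)%E ->
        v2 (B32 n) = (1%:E + v2 (a * (a + 1)))%E,
      n = 2 %[mod 4] -> v2 (B32 n) = 0%:E
    & n = 3 %[mod 4] -> v2 (B32 n) = 0%:E].
Proof.
split.
- by apply: (@v2_B32_class 8 4 1); [|vm_compute].
- by apply: (@v2_B32_class 16 8 3); [|vm_compute].
- by move=> a ->; apply: v2_B32_1mod4.
- by apply: (@v2_B32_class 4 2 0); [|vm_compute].
- by apply: (@v2_B32_class 4 3 0); [|vm_compute].
Qed.
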